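(* If $A$ is a separable object in a cartesian bicategory $\mathbf{B}$, then, for all objects $X$ of $\mathbf{B}$, the hom category $\mathrm{Map}\,\mathbf{B}(X,A)$ is an ordered set, meaning that the category structure forms a reflexive, transitive relation (there is at most one 2-cell between any two maps $X\to A$).
   Context: Bicategories are taken normal (identity constraints strict). A map in a bicategory $\mathbf{B}$ is an arrow $f$ having a right adjoint; a chosen right adjoint is written $f^*$, with unit $\eta_f:1\to f^*f$ and counit $\epsilon_f:ff^*\to 1$. $\mathrm{Map}\,\mathbf{B}$ is the locally full subbicategory of $\mathbf{B}$ with the same objects, the maps as arrows, and all 2-cells between them. Limits in bicategories are meant in the bicategorical sense. Cartesian bicategory: $\mathbf{B}$ is cartesian if (1) $\mathrm{Map}\,\mathbf{B}$ has finite products $\times$, $1$, with projections $p,r$; (2) each hom category $\mathbf{B}(X,A)$ has finite products, written $\wedge,\top$; (3) the following canonical lax functors $\otimes:\mathbf{B}\times\mathbf{B}\to\mathbf{B}$ and $I:\mathbf{1}\to\mathbf{B}$ are pseudofunctors (their constraints are invertible). On objects $X\otimes Y=X\times Y$; for arrows $R:X\to A$, $S:Y\to B$, $R\otimes S=(p_{A,B}^*\,R\,p_{X,Y})\wedge(r_{A,B}^*\,S\,r_{X,Y})$; the constraint $1_{X\otimes Y}\to 1_X\otimes 1_Y$ is induced by the units $\eta_p,\eta_r$, and $(R'\otimes S')(R\otimes S)\to (R'R)\otimes(S'S)$ is induced by the local projections and the counits $\epsilon_p,\epsilon_r$. $I$ picks the object $I=1$ with the arrow $\top_{I,I}$, with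 constraints the unique 2-cells $1_I\to\top_{I,I}$ and $\top_{I,I}\top_{I,I}\to\top_{I,I}$. An object $A$ is separable if, for the diagonal map $d_A:A\to A\otimes A$, the unit $\eta_{d_A}:1_A\to d_A^*d_A$ is invertible. *)

(* Defs.v *)
From Corelib Require Import ssreflect ssrfun.
From Stdlib Require Import RelationClasses.

Set Implicit Arguments.
Unset Strict Implicit.
Unset Printing Implicit Defensive.

Declare Scope bicat_scope.
Delimit Scope bicat_scope with bicat.
Local Open Scope bicat_scope.

Record category := Category {
  cob :> Type;
  chom : cob -> cob -> Type;
  cid : forall x, chom x x;
  ccomp : forall x y z, chom y z -> chom x y -> chom x z;
  ccompA : forall x y z w (h : chom z w) (g : chom y z) (f : chom x y),
    ccomp h (ccomp g f) = ccomp (ccomp h g) f;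
  ccomp1l : forall x y (f : chom x y), ccomp (cid y) f = f;
  ccomp1r : forall x y (f : chom x y), ccomp f (cid x) = f
}.

Arguments chom {_} _ _.
Arguments cid {_} _.
Arguments ccomp {_ _ _ _} _ _.

Notation "x ~> y" := (chom x y) (at level 90, no associativity) : bicat_scope.
Notation "g • f" := (ccomp g f) (at level 50, left associativity) : bicat_scope.

Definition is_invertible (C : category) (x y : C) (f : x ~> y) : Prop :=
  exists g : y ~> x, g • f = cid x /\ f • g = cid y.

Record iso (C : category) (x y : C) := Iso {
  fwd :> x ~> y;
  bwd : y ~> x;
  bwdK : bwd • fwd = cid x;
  fwdK : fwd • bwd = cid y
}.

Notation "i ^-1" := (bwd i) (at level 3, left associativity, format "i ^-1")
  : bicat_scope.

Record functor (C D : category) := Functor {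
  fob :> C -> D;
  fhom : forall x y : C, (x ~> y) -> (fob x ~> fob y);
  fhom_id : forall x, fhom (cid x) = cid (fob x);
  fhom_comp : forall (x y z : C) (g : y ~> z) (f : x ~> y),
    fhom (g • f) = fhom g • fhom f
}.

Definition functor_id (C : category) : functor C C :=
  @Functor C C (fun x => x) (fun _ _ f => f)
    (fun _ => eq_refl) (fun _ _ _ _ _ => eq_refl).

Lemma functor_comp_id (C D E : category) (G : functor D E) (F : functor C D)
  (x : C) : fhom G (fhom F (cid x)) = cid (G (F x)).
Proof. by rewrite !fhom_id. Qed.

Lemma functor_comp_comp (C D E : category) (G : functor D E) (F : functor C D)
  (x y z : C) (g : y ~> z) (f : x ~> y) :
  fhom G (fhom F (g • f)) = fhom G (fhom F g) • fhom G (fhom F f).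
Proof. by rewrite !fhom_comp. Qed.

Definition functor_comp (C D E : category) (G : functor D E) (F : functor C D) :
  functor C E :=
  @Functor C E (fun x => G (F x)) (fun _ _ f => fhom G (fhom F f))
    (functor_comp_id G F) (functor_comp_comp G F).

Record nat_iso (C D : category) (F G : functor C D) := NatIso {
  nat_iso_at :> forall x : C, iso (F x) (G x);
  nat_iso_natural : forall (x y : C) (f : x ~> y),
    fwd (nat_iso_at y) • fhom F f = fhom G f • fwd (nat_iso_at x)
}.

Record equivalence (C D : category) (F : functor C D) := Equivalence {
  equiv_inv : functor D C;
  equiv_unit : nat_iso (functor_id C) (functor_comp equiv_inv F);
  equiv_counit : nat_iso (functor_comp F equiv_inv) (functor_id D)
}.

Definition prod_cat (C D : category) : category.
Proof.
refine (@Category (C * D)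
  (fun x y => (fst x ~> fst y) * (snd x ~> snd y))%type
  (fun x => (cid (fst x), cid (snd x)))
  (fun _ _ _ g f => (fst g • fst f, snd g • snd f)) _ _ _).
- by move=> *; rewrite !ccompA.
- by move=> x y [f f'] /=; rewrite !ccomp1l.
- by move=> x y [f f'] /=; rewrite !ccomp1r.
Defined.

Definition unit_cat : category.
Proof.
refine (@Category unit (fun _ _ => unit) (fun _ => tt) (fun _ _ _ _ _ => tt)
  _ _ _) => //.
- by move=> ? ? [].
- by move=> ? ? [].
Defined.

Definition full_subcat (C : category) (P : C -> Prop) : category :=
  @Category {x : C | P x} (fun x y => proj1_sig x ~> proj1_sig y)
    (fun x => cid (proj1_sig x)) (fun _ _ _ g f => g • f)
    (fun _ _ _ _ h g f => ccompA h g f)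
    (fun _ _ f => ccomp1l f) (fun _ _ f => ccomp1r f).

Record cat_product (C : category) (x y : C) := CatProduct {
  cprod : C;
  cproj1 : cprod ~> x;
  cproj2 : cprod ~> y;
  cpair : forall z : C, (z ~> x) -> (z ~> y) -> (z ~> cprod);
  cpair1 : forall (z : C) (f : z ~> x) (g : z ~> y), cproj1 • cpair f g = f;
  cpair2 : forall (z : C) (f : z ~> x) (g : z ~> y), cproj2 • cpair f g = g;
  cpair_uniq : forall (z : C) (h : z ~> cprod),
    h = cpair (cproj1 • h) (cproj2 • h)
}.

Arguments cpair {C x y} _ {z} _ _.

Record cat_terminal (C : category) := CatTerminal {
  cterm : C;
  cbang : forall z : C, z ~> cterm;
  cbang_uniq : forall (z : C) (h : z ~> cterm), h = cbang z
}.

Definition is_ordered_set (C : category) : Prop :=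
  PreOrder (fun x y : C => inhabited (x ~> y)) /\
  forall (x y : C) (f g : x ~> y), f = g.

(* [comp g f] is "g after f".  *)
Record bicategory := Bicategory {
  ob :> Type;
  hom : ob -> ob -> category;
  one : forall X, hom X X;
  comp : forall X Y Z, hom Y Z -> hom X Y -> hom X Z;
  hcomp : forall X Y Z (g g' : hom Y Z) (f f' : hom X Y),
    (g ~> g') -> (f ~> f') -> (comp g f ~> comp g' f');
  hcomp_id : forall X Y Z (g : hom Y Z) (f : hom X Y),
    hcomp (cid g) (cid f) = cid (comp g f);
  hcomp_comp : forall X Y Z (g g' g'' : hom Y Z) (f f' f'' : hom X Y)
    (b' : g' ~> g'') (b : g ~> g') (a' : f' ~> f'') (a : f ~> f'),
    hcomp (b' • b) (a' • a) = hcomp b' a' • hcomp b a;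
  assoc : forall X Y Z W (h : hom Z W) (g : hom Y Z) (f : hom X Y),
    iso (comp (comp h g) f) (comp h (comp g f));
  lunit : forall X Y (f : hom X Y), iso (comp (one Y) f) f;
  runit : forall X Y (f : hom X Y), iso (comp f (one X)) f;
  assoc_natural : forall X Y Z W (h h' : hom Z W) (g g' : hom Y Z)
    (f f' : hom X Y) (c : h ~> h') (b : g ~> g') (a : f ~> f'),
    assoc h' g' f' • hcomp (hcomp c b) a
    = hcomp c (hcomp b a) • assoc h g f;
  lunit_natural : forall X Y (f f' : hom X Y) (a : f ~> f'),
    lunit f' • hcomp (cid (one Y)) a = a • lunit f;
  runit_natural : forall X Y (f f' : hom X Y) (a : f ~> f'),
    runit f' • hcomp a (cid (one X)) = a • runit f;
  pentagon : forall X Y Z W V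
    (k : hom W V) (h : hom Z W) (g : hom Y Z) (f : hom X Y),
    assoc k h (comp g f) • assoc (comp k h) g f
    = hcomp (cid k) (assoc h g f) • assoc k (comp h g) f
      • hcomp (assoc k h g) (cid f);
  triangle : forall X Y Z (g : hom Y Z) (f : hom X Y),
    hcomp (cid g) (lunit f) • assoc g (one Y) f = hcomp (runit g) (cid f)
}.

Arguments hom {_} _ _.
Arguments one {_} _.
Arguments comp {_ _ _ _} _ _.
Arguments hcomp {_ _ _ _ _ _ _ _} _ _.
Arguments assoc {_ _ _ _ _} _ _ _.
Arguments lunit {_ _ _} _.
Arguments runit {_ _ _} _.

Notation "g ∘ f" := (comp g f) (at level 40, left associativity) : bicat_scope.
Notation "g ◃ a" := (hcomp (cid g) a) (at level 40, left associativity)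
  : bicat_scope.
Notation "b ▹ f" := (hcomp b (cid f)) (at level 40, left associativity)
  : bicat_scope.

Definition cell_of_eq (C : category) (x y : C) (e : x = y) : x ~> y :=
  match e in _ = z return x ~> z with eq_refl => cid x end.

Definition normal (B : bicategory) : Prop :=
  forall (X Y : B) (f : hom X Y),
    (exists e : one Y ∘ f = f, fwd (lunit f) = cell_of_eq e) /\
    (exists e : f ∘ one X = f, fwd (runit f) = cell_of_eq e).

Section BicategoricalProducts.
Variable C : bicategory.

Lemma span_id (X Y P Z : C) (p : hom P X) (r : hom P Y) (h : hom Z P) :
  (p ◃ cid h, r ◃ cid h) = @cid (prod_cat (hom Z X) (hom Z Y)) (p ∘ h, r ∘ h).
Proof. by rewrite !hcomp_id. Qed.

Lemma span_comp (X Y P Z : C) (p : hom P X) (r : hom P Y) (h h' h'' : hom Z P)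
  (b : h' ~> h'') (a : h ~> h') :
  (p ◃ (b • a), r ◃ (b • a))
  = @ccomp (prod_cat (hom Z X) (hom Z Y)) (p ∘ h, r ∘ h) (p ∘ h', r ∘ h')
      (p ∘ h'', r ∘ h'') (p ◃ b, r ◃ b) (p ◃ a, r ◃ a).
Proof.
by rewrite -{1}(ccomp1l (cid p)) -{1}(ccomp1l (cid r)) !hcomp_comp.
Qed.

Definition span_functor (X Y P : C) (p : hom P X) (r : hom P Y) (Z : C) :
  functor (hom Z P) (prod_cat (hom Z X) (hom Z Y)) :=
  @Functor (hom Z P) (prod_cat (hom Z X) (hom Z Y))
    (fun h => (p ∘ h, r ∘ h)) (fun _ _ a => (p ◃ a, r ◃ a))
    (span_id p r) (span_comp p r).

Definition functor_to_unit (D : category) : functor D unit_cat :=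
  @Functor D unit_cat (fun _ => tt) (fun _ _ _ => tt)
    (fun _ => eq_refl) (fun _ _ _ _ _ => eq_refl).

Record bicat_product (X Y : C) := BicatProduct {
  bprod : C;
  bproj1 : hom bprod X;
  bproj2 : hom bprod Y;
  bprod_equiv : forall Z : C, equivalence (span_functor bproj1 bproj2 Z)
}.

Record bicat_terminal := BicatTerminal {
  bterm : C;
  bterm_equiv : forall Z : C, equivalence (functor_to_unit (hom Z bterm))
}.

Record finite_products := FiniteProducts {
  fin_prod : forall X Y : C, bicat_product X Y;
  fin_term : bicat_terminal
}.

End BicategoricalProducts.

Definition bpair (C : bicategory) (X Y Z : C) (P : bicat_product X Y)
  (f : hom Z X) (g : hom Z Y) : hom Z (bprod P) :=
  equiv_inv (bprod_equiv P Z) (f, g).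

Record right_adjoint (B : bicategory) (X A : B) (f : hom X A) := RightAdjoint {
  radj :> hom A X;
  radj_unit : one X ~> radj ∘ f;
  radj_counit : f ∘ radj ~> one A;
  radj_left : lunit f • (radj_counit ▹ f) • (assoc f radj f)^-1
              • (f ◃ radj_unit) = runit f;
  radj_right : runit radj • (radj ◃ radj_counit) • assoc radj f radj
               • (radj_unit ▹ radj) = lunit radj
}.

Definition is_map (B : bicategory) (X A : B) (f : hom X A) : Prop :=
  inhabited (right_adjoint f).

Lemma rw2 (C : category) (w x y y' z : C) (g : y ~> z) (f : x ~> y)
  (g' : y' ~> z) (f' : x ~> y') :
  g • f = g' • f' -> forall h : z ~> w, h • g • f = h • g' • f'.
Proof. by move=> e h; rewrite -!ccompA e. Qed.

Lemma rw21 (C : category) (w x y z : C) (g : y ~> z) (f : x ~> y) (k : x ~> z) :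
  g • f = k -> forall h : z ~> w, h • g • f = h • k.
Proof. by move=> e h; rewrite -!ccompA e. Qed.

(* [chain e] rewrites by [e : g • f = k] inside a left-associated composite.  *)
Ltac chain e := first
  [ rewrite e | rewrite (rw2 e) | rewrite (rw21 e) ].

Section Composition.

Lemma iso_monic (C : category) (x y z : C) (i : iso y z) (f g : x ~> y) :
  i • f = i • g -> f = g.
Proof.
by move=> e; rewrite -(ccomp1l f) -(bwdK i) -ccompA e ccompA bwdK ccomp1l.
Qed.

Lemma iso_epic (C : category) (x y z : C) (i : iso x y) (f g : y ~> z) :
  f • i = g • i -> f = g.
Proof.
by move=> e; rewrite -(ccomp1r f) -(fwdK i) ccompA e -ccompA fwdK ccomp1r.
Qed.

Variable B : bicategory.
Implicit Types X Y Z W : B.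

Lemma lwhisk_comp X Y Z (g : hom Y Z) (f f' f'' : hom X Y)
  (b : f' ~> f'') (a : f ~> f') : g ◃ (b • a) = (g ◃ b) • (g ◃ a).
Proof. by rewrite -hcomp_comp ccomp1l. Qed.

Lemma rwhisk_comp X Y Z (g g' g'' : hom Y Z) (f : hom X Y)
  (b : g' ~> g'') (a : g ~> g') : (b • a) ▹ f = (b ▹ f) • (a ▹ f).
Proof. by rewrite -hcomp_comp ccomp1l. Qed.

Lemma whisk_exchange X Y Z (g g' : hom Y Z) (f f' : hom X Y)
  (b : g ~> g') (a : f ~> f') : (g' ◃ a) • (b ▹ f) = (b ▹ f') • (g ◃ a).
Proof. by rewrite -!hcomp_comp !ccomp1l !ccomp1r. Qed.

Lemma iso_lwhisk X Y Z (g : hom Y Z) (f f' : hom X Y) (i : iso f f') :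
  iso (g ∘ f) (g ∘ f').
Proof.
exists (g ◃ i) (g ◃ i^-1).
- by rewrite -lwhisk_comp bwdK hcomp_id.
- by rewrite -lwhisk_comp fwdK hcomp_id.
Defined.

Lemma iso_rwhisk X Y Z (g g' : hom Y Z) (f : hom X Y) (i : iso g g') :
  iso (g ∘ f) (g' ∘ f).
Proof.
exists (i ▹ f) (i^-1 ▹ f).
- by rewrite -rwhisk_comp bwdK hcomp_id.
- by rewrite -rwhisk_comp fwdK hcomp_id.
Defined.

Lemma assoc_natural_inv X Y Z W (h h' : hom Z W) (g g' : hom Y Z)
    (f f' : hom X Y) (c : h ~> h') (b : g ~> g') (a : f ~> f') :
    (assoc h' g' f')^-1 • hcomp c (hcomp b a)
    = hcomp (hcomp c b) a • (assoc h g f)^-1.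
Proof.
apply: (iso_monic (i := assoc h' g' f')).
apply: (iso_epic (i := assoc h g f)).
rewrite ?ccompA fwdK ccomp1l assoc_natural -[RHS]ccompA bwdK ccomp1r.
by [].
Qed.

Lemma lwhisk_inj X Y (f f' : hom X Y) (a b : f ~> f') :
  one Y ◃ a = one Y ◃ b -> a = b.
Proof.
move=> e; apply: (iso_epic (i := lunit f)).
by rewrite -!lunit_natural e.
Qed.

Lemma rwhisk_inj X Y (f f' : hom X Y) (a b : f ~> f') :
  a ▹ one X = b ▹ one X -> a = b.
Proof.
move=> e; apply: (iso_epic (i := runit f)).
by rewrite -!runit_natural e.
Qed.

Lemma lunit_comp X Y Z (g : hom Y Z) (f : hom X Y) :
  lunit (g ∘ f) • assoc (one Z) g f = lunit g ▹ f.
Proof.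
apply: lwhisk_inj; rewrite lwhisk_comp.
apply: (iso_epic (i := assoc _ _ _)).
apply: (iso_epic (i := iso_rwhisk f (assoc _ _ _))) => /=.
rewrite -!ccompA [in LHS]ccompA -[_ • (_ • (assoc _ _ _ ▹ f))]ccompA.
have := pentagon (one Z) (one Z) g f; rewrite -!ccompA => <-.
rewrite ccompA triangle.
rewrite [in RHS]ccompA -assoc_natural -[in RHS]ccompA -rwhisk_comp triangle.
by rewrite assoc_natural hcomp_id.
Qed.

Lemma runit_comp X Y Z (g : hom Y Z) (f : hom X Y) :
  (g ◃ runit f) • assoc g f (one X) = runit (g ∘ f).
Proof.
apply: rwhisk_inj; rewrite rwhisk_comp.
apply: (iso_monic (i := assoc _ _ _)).
rewrite ccompA assoc_natural -!triangle lwhisk_comp.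
have := pentagon g f (one X) (one X); rewrite -!ccompA => <-.
by rewrite ?ccompA -assoc_natural hcomp_id.
Qed.

Lemma lwhisk_bwdK X Y Z (g : hom Y Z) (f f' : hom X Y) (i : iso f f') :
  (g ◃ i^-1) • (g ◃ i) = cid (g ∘ f).
Proof. exact: (bwdK (iso_lwhisk g i)). Qed.

Lemma lwhisk_fwdK X Y Z (g : hom Y Z) (f f' : hom X Y) (i : iso f f') :
  (g ◃ i) • (g ◃ i^-1) = cid (g ∘ f').
Proof. exact: (fwdK (iso_lwhisk g i)). Qed.

Lemma rwhisk_bwdK X Y Z (g g' : hom Y Z) (f : hom X Y) (i : iso g g') :
  (i^-1 ▹ f) • (i ▹ f) = cid (g ∘ f).
Proof. exact: (bwdK (iso_rwhisk f i)). Qed.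

Lemma rwhisk_fwdK X Y Z (g g' : hom Y Z) (f : hom X Y) (i : iso g g') :
  (i ▹ f) • (i^-1 ▹ f) = cid (g' ∘ f).
Proof. exact: (fwdK (iso_rwhisk f i)). Qed.

Lemma pentagon_inv X Y Z W V
    (k : hom W V) (h : hom Z W) (g : hom Y Z) (f : hom X Y) :
  ((assoc k h g)^-1 ▹ f) • (assoc k (h ∘ g) f)^-1 • (k ◃ (assoc h g f)^-1)
  = (assoc (k ∘ h) g f)^-1 • (assoc k h (g ∘ f))^-1.
Proof.
apply: (iso_epic (i := assoc k h (g ∘ f))).
apply: (iso_epic (i := assoc (k ∘ h) g f)).
chain (pentagon k h g f); rewrite ?ccompA.
chain (lwhisk_bwdK k (assoc h g f)); rewrite ccomp1r.
chain (bwdK (assoc k (h ∘ g) f)); rewrite ccomp1r rwhisk_bwdK.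
by chain (bwdK (assoc k h (g ∘ f))); rewrite ccomp1r bwdK.
Qed.

Lemma lwhisk_assoc X Y Z W (h : hom Z W) (g : hom Y Z) (f f' : hom X Y)
    (a : f ~> f') :
  assoc h g f' • ((h ∘ g) ◃ a) = (h ◃ (g ◃ a)) • assoc h g f.
Proof. by rewrite -hcomp_id assoc_natural. Qed.

Lemma lwhisk_assoc_inv X Y Z W (h : hom Z W) (g : hom Y Z) (f f' : hom X Y)
    (a : f ~> f') :
  (assoc h g f')^-1 • (h ◃ (g ◃ a)) = ((h ∘ g) ◃ a) • (assoc h g f)^-1.
Proof. by rewrite assoc_natural_inv hcomp_id. Qed.

Lemma rwhisk_assoc X Y Z W (h h' : hom Z W) (g : hom Y Z) (f : hom X Y)
    (c : h ~> h') :
  assoc h' g f • ((c ▹ g) ▹ f) = (c ▹ (g ∘ f)) • assoc h g f.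
Proof. by rewrite assoc_natural hcomp_id. Qed.

Lemma rwhisk_assoc_inv X Y Z W (h h' : hom Z W) (g : hom Y Z) (f : hom X Y)
    (c : h ~> h') :
  (assoc h' g f)^-1 • (c ▹ (g ∘ f)) = ((c ▹ g) ▹ f) • (assoc h g f)^-1.
Proof. by rewrite -assoc_natural_inv hcomp_id. Qed.

Lemma lunit_comp_inv X Y Z (g : hom Y Z) (f : hom X Y) :
  (lunit g ▹ f) • (assoc (one Z) g f)^-1 = lunit (g ∘ f).
Proof. by rewrite -lunit_comp -ccompA fwdK ccomp1r. Qed.

Lemma triangle_inv X Y Z (g : hom Y Z) (f : hom X Y) :
  (runit g ▹ f) • (assoc g (one Y) f)^-1 = g ◃ lunit f.
Proof. by rewrite -triangle -ccompA fwdK ccomp1r. Qed.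

Lemma pentagon_shift X Y Z W V
    (k : hom W V) (h : hom Z W) (g : hom Y Z) (f : hom X Y) :
  (assoc k h (g ∘ f))^-1 • (k ◃ assoc h g f)
  = assoc (k ∘ h) g f • ((assoc k h g)^-1 ▹ f) • (assoc k (h ∘ g) f)^-1.
Proof.
apply: (iso_monic (i := assoc k h (g ∘ f))).
rewrite !ccompA fwdK ccomp1l pentagon.
chain (rwhisk_fwdK f (assoc k h g)); rewrite ccomp1r.
by chain (fwdK (assoc k (h ∘ g) f)); rewrite ccomp1r.
Qed.

Section CompositeAdjoint.
Variables (X Y Z : B) (f : hom X Y) (g : hom Y Z) (u : hom Y X) (v : hom Z Y).
Variables (eta_f : one X ~> u ∘ f) (eps_f : f ∘ u ~> one Y).
Variables (eta_g : one Y ~> v ∘ g) (eps_g : g ∘ v ~> one Z).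

Definition composite_unit : one X ~> (u ∘ v) ∘ (g ∘ f) :=
  (assoc u v (g ∘ f))^-1
  • (u ◃ (assoc v g f • (eta_g ▹ f) • (lunit f)^-1)) • eta_f.

Definition composite_counit : (g ∘ f) ∘ (u ∘ v) ~> one Z :=
  eps_g • (g ◃ (lunit v • (eps_f ▹ v) • (assoc f u v)^-1))
  • assoc g f (u ∘ v).

Hypothesis left_f :
  lunit f • (eps_f ▹ f) • (assoc f u f)^-1 • (f ◃ eta_f) = runit f.
Hypothesis left_g :
  lunit g • (eps_g ▹ g) • (assoc g v g)^-1 • (g ◃ eta_g) = runit g.

Lemma left_transpose (k : hom X Y) (t : f ~> k) :
  lunit k • (eps_f ▹ k) • (assoc f u k)^-1 • (f ◃ ((u ◃ t) • eta_f))
  = t • runit f.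
Proof.
rewrite lwhisk_comp ccompA; chain (lwhisk_assoc_inv f u t).
chain (esym (whisk_exchange eps_f t)); rewrite lunit_natural.
by rewrite -left_f !ccompA.
Qed.

Lemma counit_step (W : B) (k : hom W Z) :
  ((lunit v • (eps_f ▹ v) • (assoc f u v)^-1) ▹ k)
  • (assoc f (u ∘ v) k)^-1 • (f ◃ (assoc u v k)^-1)
  = lunit (v ∘ k) • (eps_f ▹ (v ∘ k)) • (assoc f u (v ∘ k))^-1.
Proof.
rewrite !rwhisk_comp.
have := pentagon_inv f u v k; rewrite -!ccompA => ->; rewrite ?ccompA.
chain (esym (rwhisk_assoc_inv v k eps_f)).
by rewrite lunit_comp_inv.
Qed.

Lemma unit_step :
  lunit (g ∘ f) • (eps_g ▹ (g ∘ f)) • (assoc g v (g ∘ f))^-1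
  • (g ◃ (assoc v g f • (eta_g ▹ f) • (lunit f)^-1)) = cid (g ∘ f).
Proof.
rewrite !lwhisk_comp !ccompA.
chain (pentagon_shift g v g f); rewrite ?ccompA.
chain (esym (rwhisk_assoc g f eps_g)); rewrite lunit_comp.
chain (assoc_natural_inv (cid g) eta_g (cid f)); rewrite ?ccompA.
by rewrite -!rwhisk_comp left_g triangle_inv lwhisk_fwdK.
Qed.

Lemma composite_left :
  lunit (g ∘ f) • (composite_counit ▹ (g ∘ f))
  • (assoc (g ∘ f) (u ∘ v) (g ∘ f))^-1 • ((g ∘ f) ◃ composite_unit)
  = runit (g ∘ f).
Proof.
rewrite /composite_unit /composite_counit.
set t := assoc v g f • _ • _; set c := lunit v • _ • _.
rewrite !rwhisk_comp !ccompA.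
have e : (assoc g f (u ∘ v) ▹ (g ∘ f)) • (assoc (g ∘ f) (u ∘ v) (g ∘ f))^-1
  = (assoc g (f ∘ (u ∘ v)) (g ∘ f))^-1 • (g ◃ (assoc f (u ∘ v) (g ∘ f))^-1)
    • assoc g f ((u ∘ v) ∘ (g ∘ f)).
  apply: (iso_epic (i := assoc (g ∘ f) (u ∘ v) (g ∘ f))).
  rewrite -ccompA bwdK ccomp1r; chain (pentagon g f (u ∘ v) (g ∘ f)).
  rewrite ?ccompA; chain (lwhisk_bwdK g (assoc f (u ∘ v) (g ∘ f))).
  by rewrite ccomp1r bwdK ccomp1l.
chain e; rewrite ?ccompA.
chain (esym (assoc_natural_inv (cid g) c (cid (g ∘ f)))); rewrite ?ccompA.
rewrite ?hcomp_id.
chain (lwhisk_assoc g f ((assoc u v (g ∘ f))^-1 • (u ◃ t) • eta_f)).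
rewrite ?ccompA -(ccomp1l (runit (g ∘ f))) -[in RHS]unit_step -/t -runit_comp.
rewrite ?ccompA.
chain (esym (lwhisk_comp g t (runit f))).
rewrite -left_transpose -counit_step -/c !lwhisk_comp !ccompA.
by [].
Qed.

Lemma composite_unit_sym :
  composite_unit = assoc (u ∘ v) g f
    • (((assoc u v g)^-1 • (u ◃ eta_g) • (runit u)^-1) ▹ f) • eta_f.
Proof.
rewrite /composite_unit !lwhisk_comp !rwhisk_comp !ccompA.
rewrite pentagon_shift.
chain (assoc_natural_inv (cid u) eta_g (cid f)); rewrite ?ccompA.
congr (_ • _); rewrite -!ccompA; do 3 congr (_ • _).
apply: (iso_epic (i := iso_lwhisk u (lunit f))) => /=.
rewrite -ccompA lwhisk_bwdK ccomp1r -triangle_inv.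
by rewrite ccompA rwhisk_bwdK ccomp1l.
Qed.

Lemma composite_counit_sym :
  composite_counit = eps_g
    • ((runit g • (g ◃ eps_f) • assoc g f u) ▹ v) • (assoc (g ∘ f) u v)^-1.
Proof.
rewrite /composite_counit !lwhisk_comp !rwhisk_comp !ccompA.
apply: (iso_epic (i := assoc (g ∘ f) u v)).
rewrite -[RHS]ccompA bwdK ccomp1r.
chain (pentagon g f u v); rewrite ?ccompA.
chain (lwhisk_bwdK g (assoc f u v)); rewrite ccomp1r.
chain (esym (assoc_natural (cid g) eps_f (cid v))); rewrite ?ccompA.
by chain (triangle g v).
Qed.

End CompositeAdjoint.

End Composition.

Definition iso_sym (C : category) (x y : C) (i : iso x y) : iso y x :=
  Iso (fwdK i) (bwdK i).

(* Reversed arrows, same 2-cells.  *)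
Definition op (B : bicategory) : bicategory.
Proof.
refine (@Bicategory B (fun X Y => @hom B Y X) (fun X => one X)
  (fun _ _ _ g f => f ∘ g) (fun _ _ _ _ _ _ _ b a => hcomp a b) _ _
  (fun _ _ _ _ h g f => iso_sym (assoc f g h))
  (fun _ _ f => runit f) (fun _ _ f => lunit f) _ _ _ _ _) => /=.
- by move=> *; apply: hcomp_id.
- by move=> *; apply: hcomp_comp.
- by move=> *; apply: assoc_natural_inv.
- by move=> *; apply: runit_natural.
- by move=> *; apply: lunit_natural.
- by move=> *; rewrite -pentagon_inv.
- by move=> *; apply: triangle_inv.
Defined.

Definition right_adjoint_comp (B : bicategory) (X Y Z : B) (f : hom X Y)
  (g : hom Y Z) (u : right_adjoint f) (v : right_adjoint g) :
  right_adjoint (g ∘ f).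
Proof.
refine (@RightAdjoint B X Z (g ∘ f) (u ∘ v)
  (composite_unit (radj_unit u) (radj_unit v))
  (composite_counit (radj_counit u) (radj_counit v)) _ _).
- by apply: composite_left; apply: radj_left.
- rewrite composite_unit_sym composite_counit_sym.
  exact: (@composite_left (op B) X Y Z _ _ _ _ _ _ _ _
    (radj_right u) (radj_right v)).
Defined.

Lemma lunit_one (B : bicategory) (X : B) :
  fwd (lunit (one X)) = fwd (runit (one X)).
Proof.
apply: rwhisk_inj; rewrite -triangle -lunit_comp; congr (_ • _).
by apply: (iso_monic (i := lunit (one X))); rewrite lunit_natural.
Qed.

Definition right_adjoint_one (B : bicategory) (X : B) : right_adjoint (one X).
Proof.
refine (@RightAdjoint B X X (one X) (one X) (lunit (one X))^-1
  (lunit (one X)) _ _).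
- by rewrite {2}lunit_one; chain (triangle_inv (one X) (one X));
    chain (lwhisk_fwdK (one X) (lunit (one X))); rewrite ccomp1r lunit_one.
- by chain (triangle (one X) (one X)); rewrite -!lunit_one;
    chain (rwhisk_fwdK (one X) (lunit (one X))); rewrite ccomp1r.
Defined.

Lemma is_map_one (B : bicategory) (X : B) : is_map (one X).
Proof. exact: inhabits (right_adjoint_one X). Qed.

Lemma is_map_comp (B : bicategory) (X Y Z : B) (g : hom Y Z) (f : hom X Y) :
  is_map g -> is_map f -> is_map (g ∘ f).
Proof. by move=> [v] [u]; exact: inhabits (right_adjoint_comp u v). Qed.

Definition full_subcat_iso (C : category) (P : C -> Prop)
  (x y : full_subcat P) (i : iso (proj1_sig x) (proj1_sig y)) : iso x y :=
  @Iso (full_subcat P) x y (fwd i) (bwd i) (bwdK i) (fwdK i).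

Arguments full_subcat_iso {C P x y} & i.

Definition Map (B : bicategory) : bicategory.
Proof.
refine (@Bicategory B (fun X Y => full_subcat (@is_map B X Y))
  (fun X => exist _ (one X) (is_map_one X))
  (fun _ _ _ g f => exist _ (proj1_sig g ∘ proj1_sig f)
    (is_map_comp (proj2_sig g) (proj2_sig f)))
  (fun _ _ _ _ _ _ _ b a => hcomp b a) _ _
  (fun _ _ _ _ _ _ _ => full_subcat_iso (assoc _ _ _))
  (fun _ _ _ => full_subcat_iso (lunit _))
  (fun _ _ _ => full_subcat_iso (runit _)) _ _ _ _ _) => /=.
- by move=> *; apply: hcomp_id.
- by move=> *; apply: hcomp_comp.
- by move=> *; apply: assoc_natural.
- by move=> *; apply: lunit_natural.
- by move=> *; apply: runit_natural.
- by move=> *; apply: pentagon.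
- by move=> *; apply: triangle.
Defined.

Definition arr (B : bicategory) (X A : B) (f : @hom (Map B) X A) :
  @hom B X A := proj1_sig f.

Definition right_adjoint_choice (B : bicategory) : Type :=
  forall (X A : B) (f : @hom (Map B) X A), right_adjoint (arr f).

Record cartesian_data (B : bicategory) := CartesianData {
  radj_of : right_adjoint_choice B;
  map_products : finite_products (Map B);
  local_product : forall (X A : B) (R S : hom X A), cat_product R S;
  local_terminal : forall X A : B, cat_terminal (hom X A)
}.

Arguments radj_of {_} _ {_ _} _.

Section Cartesian.
Variables (B : bicategory) (D : cartesian_data B).
Implicit Types X Y A C E F : B.

Local Notation "f ^*" := (radj (radj_of D f))
  (at level 3, left associativity, format "f ^*").

Definition tensor X Y : B := bprod (fin_prod (map_products D) X Y).

Definition tensor_unit : B := bterm (fin_term (map_products D)).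

Definition p X Y : @hom (Map B) (tensor X Y) X :=
  bproj1 (fin_prod (map_products D) X Y).

Definition r X Y : @hom (Map B) (tensor X Y) Y :=
  bproj2 (fin_prod (map_products D) X Y).

Definition wedge X A (R S : hom X A) : hom X A := cprod (local_product D R S).

Definition local_top X A : hom X A := cterm (local_terminal D X A).

Definition tensor_arr X Y A C (R : hom X A) (S : hom Y C) :
  hom (tensor X Y) (tensor A C) :=
  wedge ((p A C)^* ∘ (R ∘ arr (p X Y))) ((r A C)^* ∘ (S ∘ arr (r X Y))).

Definition tensor_one X Y : one (tensor X Y) ~> tensor_arr (one X) (one Y) :=
  cpair (local_product D _ _)
    (((p X Y)^* ◃ (lunit (arr (p X Y)))^-1) • radj_unit (radj_of D (p X Y)))
    (((r X Y)^* ◃ (lunit (arr (r X Y)))^-1) • radj_unit (radj_of D (r X Y))).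

(* [L (R' m) (m^* (R n)) -> L ((R' R) n)], by the counit of [m -| m^*].  *)
Definition contract (P Q X A C E : B) (L : hom C E) (R' : hom A C)
  (m : @hom (Map B) P A) (R : hom X A) (n : hom Q X) :
  (L ∘ (R' ∘ arr m)) ∘ (m^* ∘ (R ∘ n)) ~> L ∘ ((R' ∘ R) ∘ n) :=
  (L ◃ ((assoc R' R n)^-1
        • (R' ◃ (lunit (R ∘ n) • (radj_counit (radj_of D m) ▹ (R ∘ n))
                 • (assoc (arr m) m^* (R ∘ n))^-1))
        • assoc R' (arr m) (m^* ∘ (R ∘ n))))
  • assoc L (R' ∘ arr m) (m^* ∘ (R ∘ n)).

Definition tensor_comp X Y A C E F
  (R' : hom A E) (S' : hom C F) (R : hom X A) (S : hom Y C) :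
  tensor_arr R' S' ∘ tensor_arr R S ~> tensor_arr (R' ∘ R) (S' ∘ S) :=
  cpair (local_product D _ _)
    (contract (p E F)^* R' (p A C) R (arr (p X Y))
     • hcomp (cproj1 (local_product D _ _)) (cproj1 (local_product D _ _)))
    (contract (r E F)^* S' (r A C) S (arr (r X Y))
     • hcomp (cproj2 (local_product D _ _)) (cproj2 (local_product D _ _))).

Definition unit_one : one tensor_unit ~> local_top tensor_unit tensor_unit :=
  cbang (local_terminal D _ _) _.

Definition unit_comp :
  local_top tensor_unit tensor_unit ∘ local_top tensor_unit tensor_unit
  ~> local_top tensor_unit tensor_unit :=
  cbang (local_terminal D _ _) _.

(* The lax functor axioms for [tensor_arr] and [local_top] with these
   constraints hold automatically, by the universal properties.  *)
Definition cartesian : Prop :=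
  (forall X Y, is_invertible (tensor_one X Y)) /\
  (forall X Y A C E F
     (R' : hom A E) (S' : hom C F) (R : hom X A) (S : hom Y C),
     is_invertible (tensor_comp R' S' R S)) /\
  is_invertible unit_one /\
  is_invertible unit_comp.

Definition diagonal A : @hom (Map B) A (tensor A A) :=
  bpair (fin_prod (map_products D) A A) (@one (Map B) A) (@one (Map B) A).

Definition separable A : Prop :=
  is_invertible (radj_unit (radj_of D (diagonal A))).

End Cartesian.

(* Main.v *)
(* The adjunction [d_A -| d_A^*] with invertible unit makes [d_A ∘ -] full.
   Followed by the equivalence [Map(X, A ⊗ A) ~ Map(X, A) × Map(X, A)], it is
   isomorphic to the diagonal functor [f |-> (f, f)], which is therefore full.
   Fullness says that every pair [(a, b)] of 2-cells [f ~> g] is of the form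
   [(c, c)], i.e. [a = b].  *)
From Corelib Require Import ssreflect ssrfun.
From Stdlib Require Import RelationClasses.
Require Import Defs.

Set Implicit Arguments.
Unset Strict Implicit.
Unset Printing Implicit Defensive.
Local Open Scope bicat_scope.

(** By naturality, [a] is recovered from [fhom F a] by conjugating with [i]. *)
Lemma nat_iso_id_faithful (C : category) (F : functor C C)
  (i : nat_iso F (functor_id C)) (x y : C) (a b : x ~> y) :
  fhom F a = fhom F b -> a = b.
Proof.
move=> e; apply: (iso_epic (i := i x)).
by rewrite -[a • _](nat_iso_natural i a) -[b • _](nat_iso_natural i b) e.
Qed.

Lemma equivalence_full (C D : category) (F : functor C D) (E : equivalence F)
  (x y : C) (k : F x ~> F y) : exists a : x ~> y, fhom F a = k.
Proof.
pose G := equiv_inv E; pose u := equiv_unit E.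
(* The candidate is [fhom G k] conjugated by the unit, so naturality of [u] makes its image under
   [G] after [F] equal to [fhom G k]; faithfulness of [F] after [G] then cancels [G]. *)
exists ((u y)^-1 • fhom G k • u x).
apply: (nat_iso_id_faithful (equiv_counit E)) => /=; congr (fhom F _).
apply: (iso_epic (i := u x)).
rewrite -[LHS](nat_iso_natural u ((u y)^-1 • fhom G k • u x)) /=.
by rewrite !ccompA fwdK ccomp1l.
Qed.

Section AdjunctionUnit.
Variables (B : bicategory) (Y Z : B) (g : hom Y Z) (v : right_adjoint g).

(** The unit at [f] of the adjunction between hom categories, [g ∘ -] left adjoint to [v ∘ -]. *)
Definition unit_at (X : B) (f : hom X Y) : f ~> v ∘ (g ∘ f) :=
  assoc v g f • (radj_unit v ▹ f) • (lunit f)^-1.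

Lemma unit_at_natural (X : B) (f f' : hom X Y) (a : f ~> f') :
  (v ◃ (g ◃ a)) • unit_at f = unit_at f' • a.
Proof.
apply: (iso_epic (i := lunit f)); rewrite /unit_at -!ccompA bwdK ccomp1r.
rewrite -lunit_natural (ccompA (lunit f')^-1) bwdK ccomp1l !ccompA.
by rewrite -lwhisk_assoc -!ccompA whisk_exchange.
Qed.

(** Transposing back along the counit, the map [T], undoes transposition by the triangle identity
    [radj_left]. *)
Lemma unit_transpose_inj (X : B) (f : hom X Y) (h : hom X Z)
  (s t : g ∘ f ~> h) :
  (v ◃ s) • unit_at f = (v ◃ t) • unit_at f -> s = t.
Proof.
pose T (w : f ~> v ∘ h) :=
  lunit h • (radj_counit v ▹ h) • (assoc g v h)^-1 • (g ◃ w).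
have TK w : T ((v ◃ w) • unit_at f) = w.
  rewrite /T lwhisk_comp ccompA; chain (lwhisk_assoc_inv g v w).
  rewrite ?ccompA; chain (esym (whisk_exchange (radj_counit v) w)).
  rewrite ?ccompA lunit_natural -!ccompA.
  have := @unit_step B X Y Z f g v _ _ (radj_left v).
  by rewrite /unit_at -!ccompA => ->; rewrite ccomp1r.
by move=> e; rewrite -(TK s) e TK.
Qed.

Hypothesis unit_invertible : is_invertible (radj_unit v).

Lemma lwhisk_full (X : B) (f f' : hom X Y) (t : g ∘ f ~> g ∘ f') :
  exists a : f ~> f', g ◃ a = t.
Proof.
case: unit_invertible => w [_ etaK].
(* [e] is a right inverse of [unit_at f'], so [e] after the transpose of [t] gives an [a] for which
   [g ◃ a] and [t] have the same transpose. *)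
pose e := lunit f' • (w ▹ f') • (assoc v g f')^-1.
exists (e • ((v ◃ t) • unit_at f)); apply: unit_transpose_inj.
rewrite unit_at_natural /e /unit_at !ccompA.
chain (bwdK (lunit f')); rewrite ccomp1r.
chain (esym (rwhisk_comp f' (radj_unit v) w)).
by rewrite etaK hcomp_id ccomp1r fwdK ccomp1l.
Qed.

End AdjunctionUnit.

Section Retraction.
Variables (C : bicategory) (X A P : C) (q : hom P A) (d : hom A P).
Variable i : iso (q ∘ d) (one A).

Definition retract_iso (f : hom X A) : iso (q ∘ (d ∘ f)) f.
Proof.
exists (lunit f • (i ▹ f) • (assoc q d f)^-1)
  (assoc q d f • (i^-1 ▹ f) • (lunit f)^-1).
- rewrite !ccompA; chain (bwdK (lunit f)); rewrite ccomp1r.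
  by chain (rwhisk_bwdK f i); rewrite ccomp1r fwdK.
- rewrite !ccompA; chain (bwdK (assoc q d f)); rewrite ccomp1r.
  by chain (rwhisk_fwdK f i); rewrite ccomp1r fwdK.
Defined.

Lemma retract_iso_natural (f g : hom X A) (a : f ~> g) :
  retract_iso g • (q ◃ (d ◃ a)) = a • retract_iso f.
Proof.
rewrite /=; chain (lwhisk_assoc_inv q d a); rewrite ?ccompA.
by chain (esym (whisk_exchange i a)); rewrite ?ccompA lunit_natural.
Qed.

(** Naturality of [retract_iso] exhibits [b] as the conjugate of [q ◃ (d ◃ b)]. *)
Lemma retract_conj (f g : hom X A) (a b : f ~> g) :
  q ◃ (d ◃ b) = (retract_iso g)^-1 • a • retract_iso f -> a = b.
Proof.
move=> e; apply: (iso_epic (i := retract_iso f)).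
rewrite -[RHS]retract_iso_natural e -(ccompA (retract_iso g)^-1).
by rewrite (ccompA (retract_iso g)) fwdK ccomp1l.
Qed.

End Retraction.

Definition prod_iso_fst (C D : category) (x y : prod_cat C D) (i : iso x y) :
  iso (fst x) (fst y) :=
  Iso (f_equal fst (bwdK i)) (f_equal fst (fwdK i)).

Definition prod_iso_snd (C D : category) (x y : prod_cat C D) (i : iso x y) :
  iso (snd x) (snd y) :=
  Iso (f_equal snd (bwdK i)) (f_equal snd (fwdK i)).

Lemma full_diagonal_cells_eq (C : bicategory) (A : C) (P : bicat_product A A)
  (X : C) (f g : hom X A) :
  let d := bpair P (one A) (one A) in
  (forall t : d ∘ f ~> d ∘ g, exists c : f ~> g, d ◃ c = t) ->
  forall a b : f ~> g, a = b.
Proof.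
move=> d full a b.
(* The components of [i] identify both projections of [d] with [one A]. *)
pose i := equiv_counit (bprod_equiv P A) (one A, one A).
pose j1 := @retract_iso C X A _ (bproj1 P) d (prod_iso_fst i).
pose j2 := @retract_iso C X A _ (bproj2 P) d (prod_iso_snd i).
have [t et] := @equivalence_full _ _ _ (bprod_equiv P X) (d ∘ f) (d ∘ g)
  ((j1 g)^-1 • a • j1 f, (j2 g)^-1 • b • j2 f).
(* The single cell [c] has projections conjugate to [a] and to [b], so it equals both. *)
have [c ec] := full t; rewrite -ec in et.
by rewrite (retract_conj (f_equal fst et)) (retract_conj (f_equal snd et)).
Qed.

Theorem proposition3p9 (B : bicategory) (hB : normal B)
  (D : cartesian_data B) (hD : cartesian D)
  (A : B) (hA : separable D A) (X : B) :
  is_ordered_set (@hom (Map B) X A).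
Proof.
split.
- split; first by move=> f; exact: inhabits (cid f).
  by move=> f g h [a] [b]; exact: inhabits (b • a).
- move=> f g; apply: full_diagonal_cells_eq => t.
  (* Cells and whiskering in [Map B] are those of [B], so fullness proved in [B] applies to [t]. *)
  exact: (lwhisk_full hA t).
Qed.
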